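(* Eleven is the least dimension $d$ for which there exist a Hadamard simplex $\Delta$ of dimension $d$ and positive odd integers $n<m<dn$ such that $P_{m,n}=m\Delta\cap[-n,n]^d$ is nonintegral, i.e. has a vertex not in $\Lambda_n=(n+2\mathbb Z)^d$. (That is, such an example exists for $d=11$ and none exists for any $d<11$.)
   Context: Hadamard simplices: let $H$ be a real Hadamard matrix of order $N$ (an $N\times N$ matrix with entries $\pm1$ and $HH^{\mathsf T}=NI$). Mark one column of $H$, multiply rows by signs so that this column becomes all ones, and delete it. With $d=N-1$, the remaining rows $v_0,\dots,v_{N-1}\in\{\pm1\}^d$ satisfy $v_i\cdot v_j=N\delta_{ij}-1$ and $\sum_i v_i=0$. The Hadamard simplex of dimension $d$ is $\Delta=\operatorname{conv}\{v_0,\dots,v_{N-1}\}\subset\mathbb R^d$; equivalently $\Delta=\{x: v_i\cdot x\ge -1\ \forall i\}$. $P_{m,n}$ is integral (a lattice polytope) if all its vertices lie in $\Lambda_n$, and nonintegral otherwise. *)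

(* Defs.v *)
From mathcomp Require Import all_boot all_order all_algebra.
From mathcomp Require Import boolp classical_sets reals.

Set Implicit Arguments.
Unset Strict Implicit.
Unset Printing Implicit Defensive.

Import Order.TTheory GRing.Theory Num.Theory.
Local Open Scope classical_set_scope.
Local Open Scope ring_scope.

Definition hadamard_mx (R : realType) (N : nat) (H : 'M[R]_N) : Prop :=
  (forall i j, H i j = 1 \/ H i j = - 1) /\ H *m H^T = N%:R%:M.

(* When H i j is 1 or -1, multiplying row i by H i j is the sign change that
   makes its entry in the marked column j equal to 1. *)
Definition hadamard_point (R : realType) (d : nat) (H : 'M[R]_d.+1)
    (j i : 'I_d.+1) : 'rV[R]_d :=
  H i j *: row i (col' j H).

Definition conv_hull (R : realType) (k d : nat) (v : 'I_k -> 'rV[R]_d) :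
    set 'rV[R]_d :=
  [set x : 'rV[R]_d | exists a : 'I_k -> R,
     [/\ forall i, 0 <= a i, \sum_i a i = 1 & x = \sum_i a i *: v i]].

Definition hadamard_simplex (R : realType) (d : nat) (D : set 'rV[R]_d) : Prop :=
  exists (H : 'M[R]_d.+1) (j : 'I_d.+1),
    hadamard_mx H /\ D = conv_hull (hadamard_point H j).

Definition cube (R : realType) (d n : nat) : set 'rV[R]_d :=
  [set x : 'rV[R]_d | forall k, - n%:R <= x 0 k <= n%:R].

(* P_{m,n} = m D /\ [-n, n]^d *)
Definition truncation (R : realType) (d : nat) (D : set 'rV[R]_d) (m n : nat) :
    set 'rV[R]_d :=
  [set m%:R *: x | x in D] `&` cube n.

Definition dot (R : realType) (d : nat) (c x : 'rV[R]_d) : R :=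
  \sum_k c 0 k * x 0 k.

(* {x} is a 0-dimensional face of the polytope P: the set where some linear
   functional attains its maximum over P. *)
Definition vertex (R : realType) (d : nat) (P : set 'rV[R]_d) (x : 'rV[R]_d) :
    Prop :=
  P x /\ exists c : 'rV[R]_d, forall y, P y -> y <> x -> dot c y < dot c x.

(* Lambda_n = (n + 2 Z)^d *)
Definition lattice (R : realType) (d n : nat) : set 'rV[R]_d :=
  [set x : 'rV[R]_d | forall k, exists z : int, x 0 k = (n%:Z + 2 * z)%:~R].

Definition nonintegral (R : realType) (d n : nat) (P : set 'rV[R]_d) : Prop :=
  exists x, vertex P x /\ ~ lattice n x.

Definition has_nonintegral_truncation (R : realType) (d : nat) : Prop :=
  exists (D : set 'rV[R]_d) (m n : nat),
    [/\ hadamard_simplex D, odd m /\ odd n, (n < m < d * n)%N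
      & nonintegral n (truncation D m n)].

(* Main.v *)
Require Import Defs.
From mathcomp Require Import all_boot all_order all_algebra.
From mathcomp Require Import boolp classical_sets reals.
From mathcomp Require Import ring lra zify.

(** A point of [m D] is a combination of the vertices of the Hadamard simplex [D]
    with nonnegative weights of sum [m].  Taking this sum as one more coordinate,
    in the place of the marked column, the weights and the extended coordinates
    determine each other through a Hadamard matrix of order [N = d + 1].  A point
    is a vertex of the truncation exactly when its zero weights and its tight
    coordinates (those equal to [n] or [- n], and the total weight) determine it
    ([vertex_rigid], [rigid_vertex]).  As [m] and [n] are odd, all tight
    coordinates are odd, and the question is whether the free ones are odd too.

    For [2 < N], a Hadamard matrix has order divisible by four, so [d < 11] leaves
    only [N = 4] and [N = 8].  A vertex has at most as many free coordinates as
    zero weights ([card_free_le]); hence it has at most three free coordinates or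
    at most four nonzero weights.

    If at most three coordinates are free, or at most three weights are nonzero,
    everything rests on [isolation]: sign vectors on at most three coordinates with
    trivial common kernel contain, for each coordinate, two that differ up to sign
    only there.  Used on rows it makes a free coordinate a signed sum of an odd
    number of odd integers ([few_free_odd]); used on columns it makes the weights
    integers ([integral_weights]), and then all coordinates have the parity of [m].

    With exactly four nonzero weights the tight columns may form a Hadamard matrix
    of order four on these rows, and the weights need not be integers.  Then either
    all columns repeat tight ones up to sign, or orthogonality makes each of the
    four rows exceptional in some column; the inequalities [|x_k| <= n] at these
    columns are incompatible with [n < m] ([few_weights_odd]).

    In dimension eleven a vertex can have six nonzero weights together with six
    free coordinates, and the Paley matrix of order twelve has such a vertex with
    half-integral weights for [m = 5] and [n = 3]
    ([nonintegral_truncation_11]). *)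

Set Implicit Arguments.
Unset Strict Implicit.
Unset Printing Implicit Defensive.

Import Order.TTheory GRing.Theory Num.Theory.
Local Open Scope ring_scope.

(** * Sign matrices with orthogonal rows *)

(** [g i k] is the sign bit of the entry [(-1) ^+ g i k] of a Hadamard matrix:
    two rows are orthogonal when they differ in exactly half of the columns.
    Bits turn the case analyses on signs below into computations. *)
Definition hadamard_signs (N : nat) (g : 'I_N -> 'I_N -> bool) : Prop :=
  forall i i', i != i' -> #|[set k | g i k (+) g i' k]|.*2 = N.

Lemma sum_sign (R : comNzRingType) (T : finType) (f : T -> bool) :
  \sum_t (-1) ^+ f t = #|T|%:R - #|[set t | f t]|.*2%:R :> R.
Proof.
have -> : #|[set t | f t]| = \sum_t (f t : nat).
  by rewrite -sum1_card big_mkcond; apply: eq_bigr => t _; rewrite inE; case: (f t).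
rewrite -mul2n big_distrr /= natr_sum -sum1_card natr_sum -sumrB.
by apply: eq_bigr => t _; case: (f t); rewrite /= ?expr0 ?expr1; ring.
Qed.

Lemma hadamard_signs_sum (R : comNzRingType) (N : nat) (g : 'I_N -> 'I_N -> bool) :
  hadamard_signs g ->
  forall i i', \sum_k (-1) ^+ g i k * (-1) ^+ g i' k = N%:R *+ (i == i') :> R.
Proof.
move=> hg i i'; under eq_bigr do rewrite -signr_addb.
rewrite sum_sign card_ord; case: eqVneq => [<-|ne]; last by rewrite hg ?subrr.
have -> : [set k | g i k (+) g i k] = finset.set0.
  by apply/setP => k; rewrite !inE addbb.
by rewrite cards0 subr0.
Qed.

(** A one-sided inverse of a square matrix is two-sided, so orthogonal rows
    force orthogonal columns. *)
Lemma hadamard_signs_sumT (R : fieldType) (N : nat) (g : 'I_N -> 'I_N -> bool) :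
  N%:R != 0 :> R -> hadamard_signs g ->
  forall k k', \sum_i (-1) ^+ g i k * (-1) ^+ g i k' = N%:R *+ (k == k') :> R.
Proof.
move=> N0 hg k k'; pose G := \matrix_(i, k) ((-1) ^+ g i k : R).
have GG : G *m (N%:R^-1 *: G^T) = 1%:M.
  apply/matrixP => i i'; rewrite -scalemxAr !mxE.
  under eq_bigr do rewrite !mxE.
  rewrite (hadamard_signs_sum _ hg); case: eqP => _; last by rewrite mulr0.
  by rewrite mulVf.
have /matrixP/(_ k k') := mulmx1C GG.
rewrite -scalemxAl !mxE => /(congr1 ( *%R N%:R)).
rewrite mulrA divff // mul1r mulr_natr => <-.
by apply: eq_bigr => i _; rewrite !mxE.
Qed.

(** For three rows [r0, r1, r2], the sum over the columns of
    [(r0 + r1) * (r0 + r2)] is [N] by orthogonality, while each term is [0] or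
    [4]. *)
Lemma hadamard_signs_dvd4 (N : nat) (g : 'I_N -> 'I_N -> bool) :
  (2 < N)%N -> hadamard_signs g -> (4 %| N)%N.
Proof.
case: N g => [//|[//|[//|N]]] g _ hg.
pose i0 : 'I_N.+3 := ord0; pose i1 : 'I_N.+3 := inord 1; pose i2 : 'I_N.+3 := inord 2.
have n01 : i0 != i1 by rewrite -val_eqE /= !inordK.
have n02 : i0 != i2 by rewrite -val_eqE /= !inordK.
have n12 : i1 != i2 by rewrite -val_eqE /= !inordK.
have := hadamard_signs_sum int hg.
set s := fun i k : 'I_N.+3 => (-1) ^+ g i k : int => hs.
have : \sum_k (s i0 k + s i1 k) * (s i0 k + s i2 k) = N.+3%:R.
  under eq_bigr do rewrite mulrDl !mulrDr.
  rewrite !big_split /= !hs eqxx (negbTE n02) (negbTE n12) eq_sym (negbTE n01).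
  by rewrite !mulr0n !addr0.
rewrite (eq_bigr (fun k => 4%:R * ((g i0 k == g i1 k) && (g i0 k == g i2 k))%:R)).
  rewrite -mulr_sumr -natr_sum -natrM natz => /eqP; rewrite natz eqz_nat => /eqP <-.
  by rewrite dvdn_mulr.
by move=> k _; rewrite /s; do 3!case: (g _ k).
Qed.

(** * Isolating a coordinate by two sign vectors *)

(** Up to the global sign [e], the sign vectors [w t] and [w u] restricted to
    [S] differ at [a] and nowhere else, so that one of [w t + w u] and
    [w t - w u] is, on [S], plus or minus twice the basis vector at [a]. *)
Definition isolates (T I : finType) (w : T -> I -> bool) (S : {set I}) (a : I)
    (t u : T) (e : bool) : Prop :=
  forall b, b \in S -> w t b (+) w u b (+) e = (b == a).

(** On at most three coordinates, a trivial common kernel forces isolation.  If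
    the relative sign of the coordinates [a] and [b] were the same for all
    vectors of [A], then a vector supported on [a] and [b] would be killed by
    [A]; so for each other [b] some two members of [A] change the sign of [a]
    relative to [b].  When there are two others [b] and [c], the two pairs so
    obtained contain one pair that changes both relative signs at once.  With
    four coordinates this fails, as the rows of a Hadamard matrix of order four
    show. *)
Lemma isolation (R : realDomainType) (T I : finType) (w : T -> I -> bool)
    (A : {set T}) (S : {set I}) :
  (#|S| <= 3)%N ->
  (forall y : I -> R, (forall i, i \notin S -> y i = 0) ->
     (forall t, t \in A -> \sum_i y i * (-1) ^+ w t i = 0) -> forall i, y i = 0) ->
  forall a, a \in S ->
  exists t u e, [/\ t \in A, u \in A & isolates w S a t u e].
Proof.
move=> cS ker a aS.
have [t0 t0A] : exists t, t \in A.
  apply/existsP; case: (boolP [exists t, t \in A]) => // /existsPn A0.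
  have := ker (fun i => (i == a)%:R) _ _ a; rewrite eqxx => k0; exfalso.
  suff : 1 = 0 :> R by apply/eqP; rewrite oner_eq0.
  apply: k0 => [i iS|t tA]; last by have := A0 t; rewrite tA.
  by case: eqP iS => // ->; rewrite aS.
(* Otherwise [delta_a - (-1) ^+ c * delta_b] is in the kernel. *)
have sep b : b \in S -> b != a ->
    exists t u, [/\ t \in A, u \in A & w t a (+) w t b != w u a (+) w u b].
  move=> bS ba; set c := w t0 a (+) w t0 b.
  case: (boolP [exists t in A, w t a (+) w t b != c]) => [/existsP[t /andP[tA tc]]|].
    by exists t, t0.
  move=> /existsPn nt.
  have cst t : t \in A -> w t b = w t a (+) c.
    move=> tA; have := nt t; rewrite tA /= negbK => /eqP <-.
    by case: (w t a); case: (w t b).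
  have := ker (fun i => (i == a)%:R - (i == b)%:R * (-1) ^+ c) _ _ a.
  rewrite eqxx eq_sym (negbTE ba) mul0r subr0 => k0; exfalso.
  suff : 1 = 0 :> R by apply/eqP; rewrite oner_eq0.
  apply: k0 => [i iS|t tA].
    have [ia ib] : i != a /\ i != b by split; apply: contraNneq iS => ->.
    by rewrite (negbTE ia) (negbTE ib) mul0r subr0.
  rewrite (bigD1 a) //= (bigD1 b) //= big1 => [|i /andP[ia ib]].
    rewrite !eqxx (negbTE ba) eq_sym (negbTE ba) cst //.
    by case: (w t a); case: c {nt cst} => /=; rewrite ?expr0 ?expr1; ring.
  by rewrite (negbTE ia) (negbTE ib) mul0r subr0 mul0r.
have : (#|S :\ a| <= 2)%N by move: cS; rewrite (cardsD1 a) aS.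
case Ec : #|S :\ a| => [|[|[|//]]] _.
(* A vector and its opposite differ everywhere, hence at the only coordinate. *)
- exists t0, t0, true; split=> // b bS.
  have : b \notin S :\ a by rewrite (cards0_eq Ec) inE.
  by rewrite !inE bS andbT negbK addbb => ->.
- have /cards1P[b Sb] : #|S :\ a| == 1%N by rewrite Ec.
  have : b \in S :\ a by rewrite Sb inE eqxx.
  rewrite !inE => /andP[ba bS].
  have [t [u [tA uA ne]]] := sep b bS ba.
  exists t, u, (w t b (+) w u b); split=> // i iS.
  have [->|ia] := eqVneq i a; first by case: (w t a) (w t b) (w u a) (w u b) ne => [] [] [] [].
  have : i \in S :\ a by rewrite !inE ia.
  by rewrite Sb inE => /eqP ->; rewrite addbb.
have /cards2P[b [c [bc Sbc]]] : #|S :\ a| == 2 by rewrite Ec.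
have : b \in S :\ a by rewrite Sbc !inE eqxx.
have : c \in S :\ a by rewrite Sbc !inE eqxx orbT.
rewrite !inE => /andP[ca cS'] /andP[ba bS].
have [t [u [tA uA]]] := sep b bS ba.
have [k [l [kA lA]]] := sep c cS' ca.
(* [p] and [q] are the signs of [a] relative to [b] and to [c]. *)
pose p t := w t a (+) w t b; pose q t := w t a (+) w t c.
rewrite -!/(p _) -!/(q _) => qkl ptu.
suff [t' [u' [tA' uA' pq]]] :
    exists t u, [/\ t \in A, u \in A & (p t != p u) && (q t != q u)].
  move: pq; rewrite /p /q => pq.
  exists t', u', (w t' b (+) w u' b); split=> // i iS.
  have [->|ia] := eqVneq i a.
    by case/andP: pq => + _; case: (w t' a) (w t' b) (w u' a) (w u' b) => [] [] [] [].
  have : i \in S :\ a by rewrite !inE ia.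
  rewrite Sbc !inE => /orP[]/eqP ->; first by rewrite addbb.
  by case: (w t' a) (w t' b) (w u' a) (w u' b) (w t' c) (w u' c) pq => [] [] [] [] [] [].
case: (eqVneq (q t) (q u)) => [qtu|]; last by exists t, u; rewrite ptu; split.
case: (eqVneq (p k) (p l)) => [pkl|]; last by exists k, l; rewrite qkl andbT; split.
have [v [vA pv]] : exists v, v \in A /\ p v != p k.
  case: (eqVneq (p t) (p k)) => [E|]; last by exists t.
  by exists u; split=> //; rewrite -E eq_sym.
case: (eqVneq (q k) (q v)) => [E|qkv]; last by exists v, k; split=> //; rewrite pv eq_sym.
by exists v, l; split=> //; rewrite -pkl pv -E.
Qed.

(** * Odd integers among the reals *)

Definition oddr (R : realType) (x : R) : Prop := (x - 1) / 2 \is a Num.int.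

Lemma oddrN (R : realType) (x : R) : oddr x -> oddr (- x).
Proof.
rewrite /oddr => ox; have -> : (- x - 1) / 2 = - ((x - 1) / 2) - 1 by field.
by rewrite rpredB ?rpredN ?rpred1.
Qed.

Lemma oddr_sign (R : realType) (b : bool) (x : R) : oddr x -> oddr ((-1) ^+ b * x).
Proof. by case: b => ox; rewrite ?mul1r // expr1 mulN1r; apply: oddrN. Qed.

Lemma oddr_half_sub (R : realType) (x y : R) :
  oddr x -> oddr y -> (x - y) / 2 \is a Num.int.
Proof.
rewrite /oddr => ox oy; have -> : (x - y) / 2 = (x - 1) / 2 - (y - 1) / 2 by field.
by rewrite rpredB.
Qed.

Lemma oddr_nat (R : realType) (n : nat) : odd n -> oddr (n%:R : R).
Proof.
move=> on; rewrite /oddr -(odd_double_half n) on natrD -mul2n natrM.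
have -> : ((1%:R + 2%:R * n./2%:R - 1) / 2 : R) = n./2%:R by field.
exact: natr_int.
Qed.

Lemma oddr_norm (R : realType) (n : nat) (x : R) : odd n -> `|x| = n%:R -> oddr x.
Proof.
move=> on; case: (ger0P x) => _ xn; first by rewrite xn; apply: oddr_nat.
by rewrite -[x]opprK xn; apply/oddrN/oddr_nat.
Qed.

Lemma sum_oddr (R : realType) (I : finType) (D : {set I}) (f : I -> R) :
  (forall i, i \in D -> oddr (f i)) -> odd #|D| -> oddr (\sum_(i in D) f i).
Proof.
move=> of_ oD; have -> : \sum_(i in D) f i = \sum_(i in D) (f i - 1) + #|D|%:R.
  by rewrite sumrB sumr_const -mulr_natl mulr1 subrK.
rewrite /oddr -addrA mulrDl rpredD //; last exact: oddr_nat.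
by rewrite mulr_suml rpred_sum // => i iD; apply: of_.
Qed.

(** * Weights of a point of the truncation *)

(** The coordinates of [sum_i a i * v_i], where the marked column, on which all
    signs are positive, contributes the sum of the weights as one more
    coordinate.  With it the points [v_i] become the orthogonal rows of a
    Hadamard matrix. *)
Definition extcoord (R : realType) (N : nat) (g : 'I_N -> 'I_N -> bool) (a : 'I_N -> R)
    (k : 'I_N) : R :=
  \sum_i a i * (-1) ^+ g i k.

Definition tight (R : realType) (N : nat) (g : 'I_N -> 'I_N -> bool) (j : 'I_N)
    (n : nat) (a : 'I_N -> R) : {set 'I_N} :=
  [set k | (k == j) || (`|extcoord g a k| == n%:R)].

(** No perturbation [u] of the weights [a] other than [0] keeps the zero weights
    and the tight coordinates, including the total weight: the form in which
    the proof uses that a point is a vertex. *)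
Definition rigid (R : realType) (N : nat) (g : 'I_N -> 'I_N -> bool) (j : 'I_N)
    (n : nat) (a : 'I_N -> R) : Prop :=
  forall u : 'I_N -> R,
    (forall i, a i = 0 -> u i = 0) ->
    (forall k, k \in tight g j n a -> extcoord g u k = 0) ->
  forall i, u i = 0.

(** The total weight is [m], rather than [1], so that the weights describe the
    points of the dilated simplex and are integers in the simplest cases. *)
Definition weights (R : realType) (N : nat) (g : 'I_N -> 'I_N -> bool)
    (j : 'I_N) (m n : nat) (a : 'I_N -> R) : Prop :=
  [/\ forall i, 0 <= a i, extcoord g a j = m%:R
    & forall k, k != j -> `|extcoord g a k| <= n%:R].

Lemma tight_odd (R : realType) (N : nat) (g : 'I_N -> 'I_N -> bool) (j : 'I_N)
    (m n : nat) (a : 'I_N -> R) :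
  odd m -> odd n -> weights g j m n a ->
  forall k, k \in tight g j n a -> oddr (extcoord g a k).
Proof.
move=> om on [_ am _] k; rewrite inE => /orP[/eqP->|/eqP]; last exact: oddr_norm.
by rewrite am; apply: oddr_nat.
Qed.

(** Besides [0] and [N], the number of columns in which two rows differ, or
    agree, is [N / 2]. *)
Lemma hadamard_signs_even (N : nat) (g : 'I_N -> 'I_N -> bool) :
  (4 %| N)%N -> hadamard_signs g ->
  forall t u e, ~~ odd #|[set k | g t k (+) g u k (+) e]|.
Proof.
move=> /dvdnP[q Nq] hg t u e.
have eN : ~~ odd N by rewrite Nq oddM andbF.
have eD : ~~ odd #|[set k | g t k (+) g u k]|.
  have [<-|tu] := eqVneq t u.
    rewrite (_ : [set k | _] = finset.set0) ?cards0 //.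
    by apply/setP => k; rewrite !inE addbb.
  by have := hg _ _ tu; lia.
case: e.
  have -> : [set k | g t k (+) g u k (+) true] = ~: [set k | g t k (+) g u k].
    by apply/setP => k; rewrite !inE addbT.
  by have := cardsC [set k | g t k (+) g u k]; rewrite card_ord; lia.
by rewrite (_ : [set k | _] = [set k | g t k (+) g u k]) //; apply/setP => k; rewrite !inE addbF.
Qed.

Lemma extcoord_row_sum (R : realType) (N : nat) (g : 'I_N -> 'I_N -> bool) (a : 'I_N -> R) :
  hadamard_signs g ->
  forall i, \sum_k extcoord g a k * (-1) ^+ g i k = N%:R * a i.
Proof.
move=> hg i; rewrite /extcoord; under eq_bigr do rewrite mulr_suml.
rewrite exchange_big (bigD1 i) //= [X in _ + X]big1 => [|i' i'i].
  under eq_bigr do rewrite -mulrA.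
  by rewrite -mulr_sumr hadamard_signs_sum // eqxx addr0 mulrC.
under eq_bigr do rewrite -mulrA.
by rewrite -mulr_sumr hadamard_signs_sum // (negbTE i'i) mulr0.
Qed.

Lemma extcoord_col_sum (R : realType) (N : nat) (g : 'I_N -> 'I_N -> bool) (y : 'I_N -> R) :
  (0 < N)%N -> hadamard_signs g ->
  forall k, extcoord g (fun i => \sum_k' y k' * (-1) ^+ g i k') k = N%:R * y k.
Proof.
move=> N0 hg k; have Nn : N%:R != 0 :> R by rewrite pnatr_eq0 -lt0n.
rewrite /extcoord; under eq_bigr do rewrite mulr_suml.
rewrite exchange_big (bigD1 k) //= [X in _ + X]big1 => [|k' k'k].
  under eq_bigr do rewrite -mulrA.
  by rewrite -mulr_sumr hadamard_signs_sumT // eqxx addr0 mulrC.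
under eq_bigr do rewrite -mulrA.
by rewrite -mulr_sumr hadamard_signs_sumT // (negbTE k'k) mulr0.
Qed.

(** Rigidity read on the side of the coordinates: a perturbation of the free
    coordinates that keeps the tight facets of the simplex is zero. *)
Lemma rigid_free (R : realType) (N : nat) (g : 'I_N -> 'I_N -> bool) (j : 'I_N)
    (n : nat) (a : 'I_N -> R) :
  hadamard_signs g -> rigid g j n a ->
  forall y : 'I_N -> R,
    (forall k, k \in tight g j n a -> y k = 0) ->
    (forall i, a i = 0 -> \sum_k y k * (-1) ^+ g i k = 0) ->
  forall k, y k = 0.
Proof.
move=> hg rg y yK yT k; have N0 : (0 < N)%N by apply: leq_ltn_trans (ltn_ord j).
have u0 := rg (fun i => \sum_k' y k' * (-1) ^+ g i k') yT.
have uK k' : k' \in tight g j n a -> extcoord g (fun i => \sum_k y k * (-1) ^+ g i k) k' = 0.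
  by move=> k'K; rewrite extcoord_col_sum // yK ?mulr0.
have /eqP := extcoord_col_sum y N0 hg k.
rewrite /extcoord big1 => [|i _]; last by rewrite u0 ?mul0r.
by rewrite eq_sym mulf_eq0 pnatr_eq0 eqn0Ngt N0 => /eqP.
Qed.

(** * Vertices with at most three free coordinates *)

(** By [isolation] applied to the rows of zero weight, each free coordinate [k]
    is isolated by two such rows [t] and [u].  Both are orthogonal to the vector
    of extended coordinates; adding or subtracting the two relations leaves a
    signed sum, over an even number of columns, of extended coordinates of which
    only the one at [k] is not known to be odd. *)
Lemma few_free_odd (R : realType) (N : nat) (g : 'I_N -> 'I_N -> bool) (j : 'I_N)
    (m n : nat) (a : 'I_N -> R) :
  (4 %| N)%N -> hadamard_signs g -> odd m -> odd n ->
  weights g j m n a -> rigid g j n a ->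
  (#|~: tight g j n a| <= 3)%N -> forall k, oddr (extcoord g a k).
Proof.
move=> N4 hg om on wa rg cF k.
have [kK|kF] := boolP (k \in tight g j n a); first exact: (tight_odd om on wa).
have kF' : k \in ~: tight g j n a by rewrite inE.
have [|t [u [e [tT uT iso]]]] := @isolation R _ _ g [set i | a i == 0] _ cF _ k kF'.
  move=> y yK yT; apply: (rigid_free hg rg) => [i iK|i ai].
    by apply: yK; rewrite inE negbK.
  by apply: yT; rewrite inE ai.
move: tT uT; rewrite !inE => /eqP at0 /eqP au0.
pose D := [set l | g t l (+) g u l (+) e].
have kD : k \in D by rewrite inE iso ?eqxx.
have : \sum_l extcoord g a l * (-1) ^+ g t l
    - (-1) ^+ e * (\sum_l extcoord g a l * (-1) ^+ g u l) = 0.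
  by rewrite !extcoord_row_sum // at0 au0; ring.
rewrite mulr_sumr -sumrB.
rewrite (eq_bigr (fun l =>
    if l \in D then 2 * ((-1) ^+ g t l * extcoord g a l) else 0)); last first.
  by move=> l _; rewrite inE; case: (g t l) (g u l) (e) => [] [] [] /=; rewrite ?expr0 ?expr1; ring.
rewrite -big_mkcond -mulr_sumr (bigD1 k) //= => /eqP.
rewrite mulf_eq0 pnatr_eq0 /= addr_eq0 => /eqP Ek.
have -> : extcoord g a k = (-1) ^+ g t k * ((-1) ^+ g t k * extcoord g a k) by rewrite signrMK.
rewrite Ek; apply/oddr_sign/oddrN.
rewrite (eq_bigl (fun l => l \in D :\ k)) => [|l]; last by rewrite !inE andbC.
apply: sum_oddr => [l|].
  rewrite !inE => /andP[lk lD]; apply/oddr_sign/(tight_odd om on wa).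
  apply/negPn/negP => lF; have := iso l; rewrite inE lF lD (negbTE lk) => /(_ isT).
  by [].
have := hadamard_signs_even N4 hg t u e; rewrite -/D (cardsD1 k) kD.
by rewrite negbK.
Qed.

(** * Vertices with at most four nonzero weights *)

(** Changing the sign of an integer changes its contribution to a sum by an even
    number, so every extended coordinate has the parity of the total weight. *)
Lemma integral_weights_odd (R : realType) (N : nat) (g : 'I_N -> 'I_N -> bool)
    (j : 'I_N) (m n : nat) (a : 'I_N -> R) :
  (forall i, ~~ g i j) -> odd m -> weights g j m n a ->
  (forall i, a i \is a Num.int) -> forall k, oddr (extcoord g a k).
Proof.
move=> gj om [_ am _] ai k; have oj : oddr (extcoord g a j) by rewrite am; apply: oddr_nat.
rewrite -[extcoord g a k](subrK (extcoord g a j)) /oddr -addrA mulrDl rpredD //.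
rewrite /extcoord -sumrB mulr_suml.
apply: rpred_sum => i _; rewrite (negbTE (gj i)) expr0; case: (g i k).
  by rewrite (_ : _ / 2 = - a i) ?rpredN // expr1; field.
by rewrite expr0 subrr mul0r rpred0.
Qed.

(** The transposed use of [isolation]: a weight is isolated by two tight columns,
    whose half sum or half difference expresses it by integers. *)
Lemma integral_weights (R : realType) (N : nat) (g : 'I_N -> 'I_N -> bool)
    (j : 'I_N) (m n : nat) (a : 'I_N -> R) (S : {set 'I_N}) :
  odd m -> odd n -> weights g j m n a -> rigid g j n a ->
  (#|S| <= 3)%N -> (forall i, i \in S -> a i != 0) ->
  (forall i, i \notin S -> a i \is a Num.int) -> forall i, a i \is a Num.int.
Proof.
move=> om on wa rg cS Sa Si i.
have [iS|] := boolP (i \in S); last exact: Si.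
have [|k [l [e [kK lK iso]]]] := @isolation R _ _ (fun k i => g i k) (tight g j n a) _ cS _ i iS.
  move=> y yS yK; apply: rg => // i' ai'.
  by apply: yS; apply/negP => /Sa; rewrite ai' eqxx.
have := oddr_half_sub (tight_odd om on wa kK) (oddr_sign e (tight_odd om on wa lK)).
rewrite /extcoord mulr_sumr -sumrB mulr_suml.
pose f i := if g i k (+) g i l (+) e then (-1) ^+ g i k * a i else 0.
rewrite (eq_bigr f) => [|i' _]; last first.
  rewrite /f; case: (g i' k) (g i' l) (e) => [] [] [] /=; rewrite ?expr0 ?expr1; by field.
have fi i' : i' != i -> f i' \is a Num.int.
  move=> i'i; have [i'S|i'S] := boolP (i' \in S).
    by rewrite /f iso // (negbTE i'i) rpred0.
  by rewrite /f; case: ifP => // _; rewrite rpredMsign Si.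
rewrite (bigD1 i) //= rpredDr; last exact: rpred_sum.
by rewrite {1}/f iso // eqxx rpredMsign.
Qed.

(** More free coordinates than tight facets would leave a nonzero solution of the
    homogeneous equations of these facets, against [rigid_free]. *)
Lemma card_free_le (R : realType) (N : nat) (g : 'I_N -> 'I_N -> bool) (j : 'I_N)
    (n : nat) (a : 'I_N -> R) :
  hadamard_signs g -> rigid g j n a ->
  (#|~: tight g j n a| <= #|[set i | a i == 0%R]|)%N.
Proof.
move=> hg rg; set F := ~: _; set T := [set i | _]; rewrite leqNgt; apply/negP => ltTF.
pose M := \matrix_(r < #|F|, c < #|T|) ((-1) ^+ g (enum_val c) (enum_val r) : R).
have : kermx M != 0.
  rewrite -mxrank_eq0 mxrank_ker subn_eq0 -ltnNge.
  exact: leq_ltn_trans (rank_leq_col _) ltTF.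
move=> /rowV0Pn[v /sub_kermxP vM v0].
pose y k := \sum_r v 0 r * (enum_val r == k)%:R.
have y0 : forall k, y k = 0.
  apply: (rigid_free hg rg) => [k kK|i ai].
    rewrite /y big1 // => r _; case: eqP => [rk|]; last by rewrite mulr0.
    by have := enum_valP r; rewrite rk inE kK.
  have iT : i \in T by rewrite inE ai.
  move/matrixP/(_ 0 (enum_rank_in iT i)): vM; rewrite !mxE; apply: etrans.
  rewrite /y; under eq_bigr do rewrite mulr_suml.
  rewrite exchange_big; apply: eq_bigr => r _; rewrite (bigD1 (enum_val r)) //= big1.
    by rewrite eqxx mulr1 addr0 mxE enum_rankK_in.
  by move=> k; rewrite eq_sym => /negbTE ->; rewrite mulr0 mul0r.
case/negP: v0; apply/eqP/rowP => r; rewrite mxE.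
have := y0 (enum_val r); rewrite /y (bigD1 r) //= big1 ?eqxx ?mulr1 ?addr0 // => r' r'r.
by rewrite (inj_eq enum_val_inj) (negbTE r'r) mulr0.
Qed.

(** Call a column odd for four rows if the product of its four signs is [-1];
    one of the rows then has the sign opposite to the other three.  All four
    rows play this part equally often.  Indeed, write [h x y] for the product of
    the signs of [x] and [y].  The differences [h p q - h r s], [h p r - h q s]
    and [h p s - h q r] vanish on the columns that are not odd, and their sum is
    [2] on an odd column unless [p] has the exceptional sign there.  Since the
    sums of all [h x y] over the columns vanish, not every odd column can have
    its exceptional sign elsewhere than at [p]. *)
Lemma odd_column_types (N : nat) (g : 'I_N -> 'I_N -> bool) (p q r s : 'I_N) :
  hadamard_signs g -> uniq [:: p; q; r; s] ->
  (exists k, g p k (+) g q k (+) g r k (+) g s k) ->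
  exists k, [/\ g q k = ~~ g p k, g r k = ~~ g p k & g s k = ~~ g p k].
Proof.
move=> hg; rewrite /= !inE !negb_or !andbT.
case/and3P => /and3P[pq pr ps] /andP[qr qs] rs [k0 ok0].
case: (pickP (fun k => [&& g q k == ~~ g p k, g r k == ~~ g p k & g s k == ~~ g p k])).
  by move=> k /and3P[/eqP ? /eqP ? /eqP ?]; exists k.
move=> no; exfalso; have o := hadamard_signs_sum int hg.
pose h i i' k := (-1) ^+ g i k * (-1) ^+ g i' k : int.
have oh i i' : i != i' -> \sum_k h i i' k = 0 by move=> /negbTE e; rewrite o e.
pose P k := g p k (+) g q k (+) g r k (+) g s k.
have : \sum_k (2 * (P k)%:R : int) = 0.
  rewrite (eq_bigr (fun k => h p q k - h r s k + (h p r k - h q s k) + (h p s k - h q r k))).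
    by rewrite !big_split /= !sumrN !oh // !subrr.
  move=> k _; have := no k; rewrite /h /P.
  by case: (g p k) (g q k) (g r k) (g s k) => [] [] [] [].
apply/eqP; rewrite psumr_neq0; last by move=> k _; case: (P k).
by apply/hasP; exists k0; rewrite ?mem_index_enum //= /P ok0.
Qed.

(** With at most three nonzero weights, [integral_weights] applies.  With four, on
    rows [p, q, r, s], a tight column that is odd for these rows (see
    [odd_column_types]) makes the weight at its exceptional row an integer, and
    the other three follow in the same way.  So let all tight columns be even.
    By rigidity they separate the four rows in all three ways into two pairs.
    If no column at all is odd, each column repeats a tight one up to sign.
    Otherwise an odd column with exceptional row [x] has extended coordinate
    plus or minus [2 * a x - m], so that [2 * a x >= m - n], and this holds for
    each of the four rows.  But a tight column separating [p, q] from [r, s]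
    gives [a p + a q - (a r + a s) = n] or [- n], so that one of these pairs has
    sum [(m - n) / 2]; both bounds on this pair give at least [m - n], which is
    too large as [n < m]. *)
Lemma few_weights_odd (R : realType) (N : nat) (g : 'I_N -> 'I_N -> bool)
    (j : 'I_N) (m n : nat) (a : 'I_N -> R) :
  hadamard_signs g -> (forall i, ~~ g i j) -> odd m -> odd n -> (n < m)%N ->
  weights g j m n a -> rigid g j n a ->
  (#|[set i | a i != 0%R]| <= 4)%N -> forall k, oddr (extcoord g a k).
Proof.
move=> hg gj om on nm wa rg; set S := [set i | _] => cS.
have Sa i : i \in S -> a i != 0 by rewrite inE.
have aS i : i \notin S -> a i = 0 by rewrite inE negbK => /eqP.
have [cS3|cS4] := leqP #|S| 3.
  apply: (integral_weights_odd gj om wa); apply: (integral_weights om on wa rg cS3 Sa).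
  by move=> i /aS ->; rewrite rpred0.
have {cS cS4} cS : #|S| = 4 by apply/eqP; rewrite eqn_leq cS.
case ES : (enum S) (cS) => [|p [|q [|r [|s []]]]]; rewrite cardE ES // => _.
have uS : uniq [:: p; q; r; s] by rewrite -ES enum_uniq.
have memS i : i \in S = (i \in [:: p; q; r; s]) by rewrite -ES mem_enum.
have sumS (F : 'I_N -> R) : (forall i, i \notin S -> F i = 0) ->
    \sum_i F i = F p + F q + F r + F s.
  move=> F0; rewrite (bigID (mem S)) /= [X in _ + X]big1 // addr0 -big_enum ES /=.
  by rewrite !big_cons big_nil addr0 !addrA.
have extS (u : 'I_N -> R) k : (forall i, i \notin S -> u i = 0) ->
    extcoord g u k = u p * (-1) ^+ g p k + u q * (-1) ^+ g q k
      + u r * (-1) ^+ g r k + u s * (-1) ^+ g s k.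
  by move=> u0; rewrite /extcoord sumS // => i /u0 ->; rewrite mul0r.
have [_ am acube] := wa.
have sum_m : a p + a q + a r + a s = m%:R.
  by rewrite -am extS // !(negbTE (gj _)) !expr0 !mulr1.
pose P k := g p k (+) g q k (+) g r k (+) g s k.
have oddE k : P k -> exists2 i, i \in S & extcoord g a k = (-1) ^+ g i k * (2 * a i - m%:R).
  move=> Pk; rewrite extS // -sum_m.
  have [pS qS rS sS] : [/\ p \in S, q \in S, r \in S & s \in S].
    by rewrite !memS !inE !eqxx !orbT.
  move: Pk; rewrite /P.
  case Ep: (g p k); case Eq: (g q k); case Er: (g r k); case Es: (g s k) => // _;
  first [ by exists p => //; rewrite ?Ep; ring | by exists q => //; rewrite ?Eq; ring
        | by exists r => //; rewrite ?Er; ring | by exists s => //; rewrite ?Es; ring ].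
have [/existsP[k /andP[kK Pk]]|/existsPn evK] := boolP [exists k in tight g j n a, P k].
  have [i iS Xk] := oddE k Pk.
  have ai : a i \is a Num.int.
    have := oddr_half_sub (oddr_sign (g i k) (tight_odd om on wa kK)) (oddrN (oddr_nat R om)).
    by rewrite Xk signrMK opprK subrK mulrAC divff ?mul1r // pnatr_eq0.
  apply: (integral_weights_odd gj om wa).
  apply: (@integral_weights _ _ _ _ _ _ _ (S :\ i) om on wa rg) => [|i'|i'].
  - by move: cS; rewrite (cardsD1 i) iS add1n => -[->].
  - by rewrite !inE => /andP[].
  by rewrite !inE; case: eqVneq => [->//|_ /= /negbNE/eqP ->]; rewrite rpred0.
(* Without such a column, [+1, +1, -1, -1] on [x, y, z, t] is a perturbation
   that contradicts rigidity. *)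
have split x y z t : uniq [:: x; y; z; t] -> {subset [:: x; y; z; t] <= [:: p; q; r; s]} ->
    (forall k, g x k (+) g y k (+) g z k (+) g t k = P k) ->
    exists k, [/\ k \in tight g j n a, g y k = g x k, g z k = ~~ g x k & g t k = ~~ g x k].
  move=> uxyzt sub eP.
  case: (pickP (fun k => [&& k \in tight g j n a, g y k == g x k, g z k == ~~ g x k
                           & g t k == ~~ g x k])) => [k /and4P[? /eqP ? /eqP ? /eqP ?]|no].
    by exists k.
  pose u i : R := (i == x)%:R + (i == y)%:R - (i == z)%:R - (i == t)%:R.
  have : u x = 0.
    apply: rg => [i ai|k kK].
      have : i \notin [:: x; y; z; t].
        by apply/negP => /sub; rewrite -memS inE ai eqxx.
      by rewrite /u !inE !negb_or => /and4P[/negbTE-> /negbTE-> /negbTE-> /negbTE->]; ring.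
    have delta i0 : \sum_i (i == i0)%:R * (-1) ^+ g i k = (-1) ^+ g i0 k :> R.
      rewrite (bigD1 i0) //= big1 ?eqxx ?addr0 ?mul1r // => i /negbTE ->.
      by rewrite mul0r.
    rewrite /extcoord /u; under eq_bigr do rewrite !mulrBl mulrDl.
    rewrite !sumrB big_split /= !delta.
    have := evK k; rewrite kK -eP /=; have := no k; rewrite kK /=.
    by case: (g x k) (g y k) (g z k) (g t k) => [] [] [] [] //= _ _; ring.
  move: uxyzt; rewrite /= !inE !negb_or /u eqxx.
  case/and3P => [/and3P[/negbTE-> /negbTE-> /negbTE->] _ _].
  by move/eqP; rewrite addr0 !subr0 oner_eq0.
have sub x y z t : all (mem [:: p; q; r; s]) [:: x; y; z; t] ->
    {subset [:: x; y; z; t] <= [:: p; q; r; s]} by move/allP.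
have [kq [kqK kq1 kq2 kq3]] : exists k, [/\ k \in tight g j n a, g q k = g p k,
    g r k = ~~ g p k & g s k = ~~ g p k] by apply: split.
have [kr [krK kr1 kr2 kr3]] : exists k, [/\ k \in tight g j n a, g r k = g p k,
    g q k = ~~ g p k & g s k = ~~ g p k].
  apply: split => [||k].
  - move: uS; rewrite /= !inE !negb_or !andbT [r == q]eq_sym.
    by move=> /and3P[/and3P[-> -> ->] /andP[-> ->] ->].
  - by apply: sub; rewrite /= !inE !eqxx !orbT.
  by rewrite /P; case: (g p k) (g q k) (g r k) (g s k) => [] [] [] [].
have [ks [ksK ks1 ks2 ks3]] : exists k, [/\ k \in tight g j n a, g s k = g p k,
    g q k = ~~ g p k & g r k = ~~ g p k].
  apply: split => [||k].
  - move: uS; rewrite /= !inE !negb_or !andbT ![s == _]eq_sym.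
    by move => /and3P[/and3P[-> -> ->] /andP[-> ->] ->].
  - by apply: sub; rewrite /= !inE !eqxx !orbT.
  by rewrite /P; case: (g p k) (g q k) (g r k) (g s k) => [] [] [] [].
have oX k := tight_odd om on wa (k := k).
have [/existsP[k0 Pk0]|/existsPn evn] := boolP [exists k, P k]; last first.
  move=> k; have := evn k; rewrite /P.
  have same k' : g q k (+) g p k = g q k' (+) g p k' -> g r k (+) g p k = g r k' (+) g p k' ->
      g s k (+) g p k = g s k' (+) g p k' -> oddr (extcoord g a k') -> oddr (extcoord g a k).
    move=> eq er es ok'.
    have sg i : g i k (+) g p k = g i k' (+) g p k' ->
        (-1) ^+ g i k = (-1) ^+ (g p k (+) g p k') * (-1) ^+ g i k' :> R.
      rewrite -signr_addb => e; congr (_ ^+ nat_of_bool _).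
      by move: e; case: (g i k) (g p k) (g i k') (g p k') => [] [] [] [].
    have -> : extcoord g a k = (-1) ^+ (g p k (+) g p k') * extcoord g a k'.
      by rewrite !extS // (sg q) // (sg r) // (sg s) // (sg p) ?addbb //; ring.
    exact: oddr_sign.
  have jK : j \in tight g j n a by rewrite inE eqxx.
  (* The eight even sign patterns, with the tight column that each repeats. *)
  case Ep: (g p k); case Eq: (g q k); case Er: (g r k); case Es: (g s k) => // _;
  [apply: (same j)|apply: (same kq)|apply: (same kr)|apply: (same ks)|
   apply: (same ks)|apply: (same kr)|apply: (same kq)|apply: (same j)];
  rewrite ?Ep ?Eq ?Er ?Es ?(negbTE (gj _)) ?kq1 ?kq2 ?kq3
    ?kr1 ?kr2 ?kr3 ?ks1 ?ks2 ?ks3 ?addbb ?addNb ?addbb //;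
  exact: oX.
exfalso.
have types x y z t : uniq [:: x; y; z; t] ->
    (forall k, g x k (+) g y k (+) g z k (+) g t k = P k) ->
    exists k, [/\ `|extcoord g a k| <= n%:R, g y k = ~~ g x k, g z k = ~~ g x k & g t k = ~~ g x k].
  move=> uxyzt eP; have [|k [k1 k2 k3]] := odd_column_types hg uxyzt.
    by exists k0; rewrite eP.
  exists k; split=> //; apply: acube; apply/eqP => kj.
  by move: k1; rewrite kj !(negbTE (gj _)).
have [xp [np p1 p2 p3]] := types p q r s uS (fun=> erefl).
have [xq [nq q1 q2 q3]] : exists k, [/\ `|extcoord g a k| <= n%:R,
    g p k = ~~ g q k, g r k = ~~ g q k & g s k = ~~ g q k].
  apply: types => [|k]; last by rewrite /P; case: (g p k) (g q k) => [] [].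
  move: uS; rewrite /= !inE !negb_or !andbT [q == p]eq_sym.
  by move=> /and3P[/and3P[-> -> ->] /andP[-> ->] ->].
have [xr [nr r1 r2 r3]] : exists k, [/\ `|extcoord g a k| <= n%:R,
    g p k = ~~ g r k, g q k = ~~ g r k & g s k = ~~ g r k].
  apply: types => [|k]; last by rewrite /P; case: (g p k) (g q k) (g r k) => [] [] [].
  move: uS; rewrite /= !inE !negb_or !andbT ![r == _]eq_sym.
  by move=> /and3P[/and3P[-> -> ->] /andP[-> ->] ->].
have [xs [ns s1 s2 s3]] : exists k, [/\ `|extcoord g a k| <= n%:R,
    g p k = ~~ g s k, g q k = ~~ g s k & g r k = ~~ g s k].
  apply: types => [|k]; last by rewrite /P; case: (g p k) (g q k) (g r k) (g s k) => [] [] [] [].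
  move: uS; rewrite /= !inE !negb_or !andbT ![s == _]eq_sym.
  by move=> /and3P[/and3P[-> -> ->] /andP[-> ->] ->].
have Nkq : `|extcoord g a kq| = n%:R.
  move: kqK; rewrite inE => /orP[/eqP kqj|/eqP//].
  by move: kq2; rewrite kqj !(negbTE (gj _)).
have nm' : n%:R < m%:R :> R by rewrite ltr_nat.
have {np} lp : m%:R - n%:R <= 2 * a p.
  move: np; rewrite extS // p1 p2 p3 -sum_m ler_norml.
  by case: (g p xp) => /andP[]; rewrite /= ?expr0 ?expr1 => ? ?; lra.
have {nq} lq : m%:R - n%:R <= 2 * a q.
  move: nq; rewrite extS // q1 q2 q3 -sum_m ler_norml.
  by case: (g q xq) => /andP[]; rewrite /= ?expr0 ?expr1 => ? ?; lra.
have {nr} lr : m%:R - n%:R <= 2 * a r.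
  move: nr; rewrite extS // r1 r2 r3 -sum_m ler_norml.
  by case: (g r xr) => /andP[]; rewrite /= ?expr0 ?expr1 => ? ?; lra.
have {ns} ls : m%:R - n%:R <= 2 * a s.
  move: ns; rewrite extS // s1 s2 s3 -sum_m ler_norml.
  by case: (g s xs) => /andP[]; rewrite /= ?expr0 ?expr1 => ? ?; lra.
move: Nkq; rewrite extS // kq1 kq2 kq3.
by case: (g p kq); case: ger0P => _ /=; rewrite ?expr0 ?expr1; lra.
Qed.

(** * Vertices and rigid weights *)

Definition coords (R : realType) (d : nat) (g : 'I_d.+1 -> 'I_d.+1 -> bool)
    (j : 'I_d.+1) (a : 'I_d.+1 -> R) : 'rV[R]_d :=
  \row_k extcoord g a (lift j k).

Definition sign_point (R : realType) (d : nat) (g : 'I_d.+1 -> 'I_d.+1 -> bool)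
    (j i : 'I_d.+1) : 'rV[R]_d :=
  \row_k (-1) ^+ g i (lift j k).

Lemma truncationP (R : realType) (d : nat) (g : 'I_d.+1 -> 'I_d.+1 -> bool)
    (j : 'I_d.+1) (m n : nat) (x : 'rV[R]_d) :
  (forall i, ~~ g i j) -> (0 < m)%N ->
  truncation (conv_hull (sign_point R g j)) m n x <->
  exists2 a, weights g j m n a & x = coords g j a.
Proof.
move=> gj m0; have m0' : m%:R != 0 :> R by rewrite pnatr_eq0 -lt0n.
split=> [[[z [b [b0 b1 zE]] xE] cx]|[a [a0 am ac] ->]].
  have xk k : x 0 k = extcoord g (fun i => m%:R * b i) (lift j k).
    rewrite -xE zE !mxE summxE mulr_sumr; apply: eq_bigr => i _.
    by rewrite !mxE mulrA.
  exists (fun i => m%:R * b i); last by apply/rowP => k; rewrite mxE xk.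
  split=> [i||k]; first by rewrite mulr_ge0 ?ler0n.
    rewrite /extcoord; under eq_bigr do rewrite (negbTE (gj _)) mulr1.
    by rewrite -mulr_sumr b1 mulr1.
  by case: (unliftP j k) => [k' ->|->] kj; rewrite ?eqxx // -?xk ?ler_norml ?cx // in kj *.
split; last by move=> k; rewrite mxE -ler_norml ac // eq_sym neq_lift.
exists (\sum_i (a i / m%:R) *: sign_point R g j i).
  exists (fun i => a i / m%:R); split=> // [i|]; first by rewrite divr_ge0.
  have sum_m : \sum_i a i = m%:R.
    by rewrite -am; apply: eq_bigr => i _; rewrite (negbTE (gj _)) mulr1.
  by rewrite -mulr_suml sum_m divff.
apply/rowP => k; rewrite !mxE summxE mulr_sumr; apply: eq_bigr => i _.
by rewrite !mxE; field.
Qed.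

(** One step length for finitely many inequalities, which turns a perturbation
    into a segment inside the polytope. *)
Lemma common_step (R : realType) (I : finType) (u v : I -> R) :
  (forall i, 0 <= u i) -> (forall i, u i = 0 -> v i = 0) ->
  exists2 e : R, 0 < e & forall i, e * `|v i| <= u i.
Proof.
move=> u0 uv; pose s := 1 + \sum_i `|v i| / u i.
have s0 : 0 < s.
  by rewrite ltr_pwDl // sumr_ge0 // => i _; rewrite divr_ge0.
exists s^-1; first by rewrite invr_gt0.
move=> i; rewrite mulrC ler_pdivrMr //.
have [ui|ui] := eqVneq (u i) 0; first by rewrite uv // ui normr0 mul0r.
have ui0 : 0 < u i by rewrite lt_def ui u0.
rewrite mulrC -ler_pdivrMr // /s (bigD1 i) //= addrCA ler_wpDr //.
by rewrite addr_ge0 // sumr_ge0 // => i' _; rewrite divr_ge0.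
Qed.

Lemma extcoordD (R : realType) (N : nat) (g : 'I_N -> 'I_N -> bool) (a u : 'I_N -> R) (c : R) k :
  extcoord g (fun i => a i + c * u i) k = extcoord g a k + c * extcoord g u k.
Proof.
by rewrite /extcoord mulr_sumr -big_split; apply: eq_bigr => i _; rewrite mulrDl mulrA.
Qed.

(** If a perturbation were not zero, small multiples of it in both directions
    would stay in the polytope, and a linear functional cannot increase strictly
    towards the midpoint of a segment from both of its ends. *)
Lemma vertex_rigid (R : realType) (d : nat) (g : 'I_d.+1 -> 'I_d.+1 -> bool)
    (j : 'I_d.+1) (m n : nat) (a : 'I_d.+1 -> R) :
  hadamard_signs g -> (forall i, ~~ g i j) -> (0 < m)%N ->
  weights g j m n a ->
  vertex (truncation (conv_hull (sign_point R g j)) m n) (coords g j a) ->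
  rigid g j n a.
Proof.
move=> hg gj m0 [a0 am ac] [_ [c cx]] u ua uK i; apply/eqP/negPn/negP => ui.
have jK : j \in tight g j n a by rewrite inE eqxx.
have [e1 e10 he1] := common_step a0 ua.
have [k|k kK|e2 e20 he2] := @common_step R _
    (fun k => if k == j then 0 else n%:R - `|extcoord g a k|) (extcoord g u).
- by case: eqP => // /eqP kj; rewrite subr_ge0 ac.
- apply: uK; rewrite inE; case: eqP kK => //= _ /eqP.
  by rewrite subr_eq0 eq_sym.
pose e := Num.min e1 e2.
have e0 : 0 < e by rewrite lt_min e10 e20.
have step s : (s == 1) || (s == -1) -> 
    truncation (conv_hull (sign_point R g j)) m n
      (coords g j (fun i => a i + s * e * u i)).
  move=> s1; apply/(truncationP n _ gj m0); exists (fun i => a i + s * e * u i) => //.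
  have sx x : - (e * `|x|) <= s * e * x <= e * `|x|.
    by case/orP: s1 => /eqP ->; case: (ger0P x) => ?; apply/andP; nra.
  split=> [i'||k kj]; last 1 first.
  - rewrite extcoordD; apply: le_trans (ler_normD _ _) _.
    have := he2 k; rewrite (negbTE kj) lerBrDl; apply: le_trans.
    rewrite lerD2l ler_norml; have := sx (extcoord g u k).
    have : e * `|extcoord g u k| <= e2 * `|extcoord g u k|.
      by rewrite ler_wpM2r // ge_min lexx orbT.
    move=> ? /andP[? ?]; apply/andP; split; lra.
  - have := sx (u i') => /andP[+ _]; have := he1 i'.
    have : e * `|u i'| <= e1 * `|u i'| by rewrite ler_wpM2r // ge_min lexx.
    lra.
  by rewrite extcoordD uK // mulr0 addr0.
have [k uk] : exists k, extcoord g u (lift j k) != 0.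
  apply/existsP; apply: contraNT ui => /existsPn uk; apply/eqP.
  have : d.+1%:R * u i = 0.
    rewrite -(extcoord_row_sum u hg) big1 // => k _.
    case: (unliftP j k) => [k' ->|->]; last by rewrite uK // mul0r.
    by have := uk k'; rewrite negbK => /eqP ->; rewrite mul0r.
  by move/eqP; rewrite mulf_eq0 pnatr_eq0 /= => /eqP.
have lin s : dot c (coords g j (fun i => a i + s * e * u i)) =
    dot c (coords g j a) + s * e * dot c (coords g j u).
  rewrite /dot mulr_sumr -big_split; apply: eq_bigr => l _.
  by rewrite !mxE extcoordD /=; ring.
have lt s : (s == 1) || (s == -1) -> s * e * dot c (coords g j u) < 0.
  move=> s1; rewrite -(ltrD2l (dot c (coords g j a))) addr0 -lin; apply: cx; first exact: step.
  move/rowP/(_ k)/eqP; rewrite !mxE extcoordD -subr_eq0 addrAC subrr add0r.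
  rewrite !mulf_eq0 (negbTE uk) (gt_eqF e0) !orbF.
  by case/orP: s1 => /eqP ->; rewrite ?oppr_eq0 oner_eq0.
have := lt 1; have := lt (-1); rewrite !eqxx orbT mul1r !mulNr mul1r => /(_ isT) + /(_ isT).
lra.
Qed.

(** The sum of the outer normals of the tight facets, of the simplex and of the
    cube, exposes the point: the loss of this functional at another point is the
    sum of the slacks of these facets, which vanishes only if all of them are
    tight there too, and then rigidity gives back the point. *)
Lemma rigid_vertex (R : realType) (d : nat) (g : 'I_d.+1 -> 'I_d.+1 -> bool)
    (j : 'I_d.+1) (m n : nat) (a : 'I_d.+1 -> R) :
  hadamard_signs g -> (forall i, ~~ g i j) -> (0 < m)%N -> (0 < n)%N ->
  weights g j m n a -> rigid g j n a ->
  vertex (truncation (conv_hull (sign_point R g j)) m n) (coords g j a).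
Proof.
move=> hg gj m0 n0 wa rg; split; first by apply/(truncationP n _ gj m0); exists a.
have [_ am ac] := wa.
(* Rows of zero weight contribute [- v_i]; the marked column is included, as both
   points have the same extended coordinate there. *)
pose C k : R := (k \in tight g j n a)%:R * Num.sg (extcoord g a k)
  - \sum_i (a i == 0)%:R * (-1) ^+ g i k.
exists (\row_k C (lift j k)) => y /(truncationP n _ gj m0)[b [b0 bm bc] ->] neq.
pose D k := (k \in tight g j n a)%:R
  * (Num.sg (extcoord g a k) * (extcoord g a k - extcoord g b k)).
pose E i := (a i == 0)%:R * (d.+1%:R * b i).
have D0 k : 0 <= D k.
  rewrite /D; case: (boolP (k \in _)) => [|_]; last by rewrite mul0r.
  rewrite inE mul1r; case: eqVneq => [->|kj]; first by rewrite am bm subrr mulr0.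
  move=> /= /eqP Xn; rewrite mulrBr -normrEsg Xn subr_ge0.
  apply: le_trans (ler_norm _) _; rewrite normrM normr_sg.
  by apply: le_trans (bc _ kj); rewrite ler_piMl //; case: eqP.
have E0 i : 0 <= E i by rewrite /E !mulr_ge0 ?ler0n.
have gap : dot (\row_k C (lift j k)) (coords g j a) - dot (\row_k C (lift j k)) (coords g j b)
    = \sum_k D k + \sum_i E i.
  transitivity (\sum_k C k * (extcoord g a k - extcoord g b k)).
    rewrite (bigD1_ord j) //= am bm subrr mulr0 add0r /dot -sumrB.
    by apply: eq_bigr => k _; rewrite !mxE mulrBr.
  under eq_bigr do rewrite mulrBl.
  rewrite sumrB; congr (_ + _); first by apply: eq_bigr => k _; rewrite /D mulrA.
  under eq_bigr do rewrite mulr_suml.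
  rewrite exchange_big -sumrN; apply: eq_bigr => i _.
  rewrite /E; case: eqP => ai; last first.
    by rewrite mul0r big1 ?oppr0 // => k _; rewrite !mul0r.
  have aT := extcoord_row_sum a hg i; rewrite ai mulr0 in aT.
  rewrite mul1r -[RHS]subr0 -[X in _ = _ - X]aT -(extcoord_row_sum b hg) -sumrB -sumrN.
  by apply: eq_bigr => k _; rewrite (_ : true%:R = 1 :> R) //; ring.
rewrite -subr_gt0 gap lt_def addr_ge0 ?sumr_ge0 // andbT.
apply: contra_notN neq; rewrite paddr_eq0 ?sumr_ge0 // !psumr_eq0 // => /andP[/allP hD /allP hE].
have u0 : forall i, b i + -1 * a i = 0.
  apply: rg => [i ai|k kK].
    move: (hE i (mem_index_enum i)); rewrite /E /= ai eqxx mul1r mulf_eq0 pnatr_eq0 /= => /eqP ->.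
    by rewrite mulr0 addr0.
  move: (hD k (mem_index_enum k)); rewrite /D /= kK mul1r mulf_eq0 sgr_eq0.
  rewrite extcoordD mulN1r => /orP[/eqP Xk|]; last by rewrite subr_eq0 => /eqP ->; rewrite subrr.
  have [kj|kj] := eqVneq k j; first by rewrite kj am bm subrr.
  by move: kK; rewrite inE (negbTE kj) Xk normr0 eq_sym pnatr_eq0 eqn0Ngt n0.
apply/rowP => k; rewrite !mxE; apply: eq_bigr => i _; congr (_ * _).
by have := u0 i; rewrite mulN1r => /subr0_eq.
Qed.

(** * Hadamard simplices of dimension less than eleven *)

Lemma hadamard_simplexP (R : realType) (d : nat) (D : set 'rV[R]_d) :
  hadamard_simplex D <->
  exists (g : 'I_d.+1 -> 'I_d.+1 -> bool) (j : 'I_d.+1),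
    [/\ hadamard_signs g, forall i, ~~ g i j & D = conv_hull (sign_point R g j)].
Proof.
split=> [[H [j [[Hs HH] ->]]]|[g [j [hg gj ->]]]].
  pose g i k := H i j * H i k == -1.
  have HE i k : H i j * H i k = (-1) ^+ g i k.
    rewrite /g; case: (Hs i j) (Hs i k) => -> [] ->; rewrite ?mulN1r ?mul1r ?opprK ?eqxx //.
      by rewrite -subr_eq0 opprK -mulr2n pnatr_eq0.
    by rewrite -subr_eq0 opprK -mulr2n pnatr_eq0.
  have HHj i : H i j * H i j = 1.
    by case: (Hs i j) => ->; rewrite ?mul1r ?mulN1r ?opprK.
  exists g, j; split.
  - move=> i i' ii'; move/matrixP/(_ i i'): HH; rewrite !mxE (negbTE ii').
    under eq_bigr do rewrite mxE.
    move=> /(congr1 ( *%R (H i j * H i' j))); rewrite mulr0 mulr_sumr.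
    under eq_bigr do rewrite mulrACA !HE -signr_addb.
    by rewrite sum_sign card_ord => /eqP; rewrite subr_eq0 eqr_nat eq_sym => /eqP.
  - by move=> i; rewrite /g HHj -subr_eq0 opprK -mulr2n pnatr_eq0.
  congr conv_hull; apply/funext => i; apply/rowP => k.
  by rewrite !mxE HE.
exists (\matrix_(i, k) (-1) ^+ g i k), j; split; first split.
- by move=> i k; rewrite mxE; case: (g i k); [right|left].
- apply/matrixP => i i'; rewrite !mxE -(hadamard_signs_sum _ hg).
  by apply: eq_bigr => k _; rewrite !mxE.
congr conv_hull; apply/funext => i; apply/rowP => k.
by rewrite !mxE (negbTE (gj i)) mul1r.
Qed.

(** A Hadamard matrix of order [N = d + 1], with [2 < N <= 11], has [N = 4] or
    [N = 8].  If more than four weights are nonzero, at most three facets of the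
    simplex are tight, hence by [card_free_le] at most three coordinates are
    free. *)
Lemma integral_truncation (R : realType) (d m n : nat) (D : set 'rV[R]_d) (x : 'rV[R]_d) :
  (d < 11)%N -> hadamard_simplex D -> odd m -> odd n -> (n < m < d * n)%N ->
  vertex (truncation D m n) x -> lattice n x.
Proof.
move=> d11 /hadamard_simplexP[g [j [hg gj ->]]] om on /andP[nm mdn] vx.
have m0 : (0 < m)%N by lia.
have [a wa xE] : exists2 a, weights g j m n a & x = coords g j a.
  by apply/(truncationP n x gj m0); case: vx.
have rg : rigid g j n a.
  by apply: (vertex_rigid hg gj m0 wa); rewrite -xE.
have d2 : (2 < d.+1)%N by case: d {g j hg gj x vx a wa xE rg D d11} mdn => [|[|]] //; lia.
have N4 := hadamard_signs_dvd4 d2 hg.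
have oa : forall k, oddr (extcoord g a k).
  have [cS|cS] := leqP #|[set i | a i != 0]%SET| 4.
    exact: (few_weights_odd hg gj om on nm wa rg).
  apply: (few_free_odd N4 hg om on wa rg); apply: leq_trans (card_free_le hg rg) _.
  have := cardsC [set i | a i != 0]%SET; rewrite card_ord.
  have -> : (~: [set i | a i != 0] = [set i | a i == 0])%SET.
    by apply/setP => i; rewrite !inE negbK.
  by case/dvdnP: N4 => q; lia.
move=> k; rewrite xE mxE; have /intrP[z Ez] := oa (lift j k).
have nE : n%:Z = 1 + 2 * (n./2)%:Z :> int by lia.
exists (z - (n./2)%:Z); rewrite nE (_ : 1 + _ + _ = 1 + 2 * z); last by ring.
by rewrite rmorphD rmorphM /= -Ez; field.
Qed.

(** * A nonintegral truncation in dimension eleven *)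

(** The Paley matrix of order twelve: [0; 1; 3; 4; 5; 9] lists [0] and the
    squares modulo [11].  Row [0] and the marked column [0] are positive. *)
Definition paley_sign (i k : nat) : bool :=
  [&& (0 < i)%N, (0 < k)%N & (k + 11 - i) %% 11 \in [:: 0; 1; 3; 4; 5; 9]]%N.

Definition paley12 (i k : 'I_12) : bool := paley_sign i k.

Lemma paley12_hadamard : hadamard_signs paley12.
Proof.
move=> i i' ii'.
have -> : #|[set k | paley12 i k (+) paley12 i' k]|
    = count (fun k => paley_sign i k (+) paley_sign i' k) (iota 0 12).
  rewrite cardsE -sum1_card -sum1_count.
  rewrite -(big_mkord (fun k => paley_sign i k (+) paley_sign i' k) (fun=> 1%N)).
  by rewrite /index_iota.
have : all (fun i => all (fun i' => (i != i') ==>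
    ((count (fun k => paley_sign i k (+) paley_sign i' k) (iota 0 12)).*2 == 12%N))
    (iota 0 12)) (iota 0 12) by vm_compute.
move/allP/(_ i); rewrite mem_iota ltn_ord => /(_ isT)/allP/(_ i').
by rewrite mem_iota ltn_ord => /(_ isT)/implyP/(_ ii')/eqP.
Qed.

(** The weights of a vertex for [m = 5] and [n = 3]: the solution of the
    equations at the columns [0; 4; 5; 6; 9; 11], with right-hand sides
    [5; 3; -3; -3; -3; 3], in the six weights that are not set to zero. *)
Definition doubled_weights : seq int := [:: 0; 1; 1; 0; 1; 5; 0; 0; 1; 1; 0; 0].
Definition doubled_coords : seq int := [:: 10; 4; 0; -4; 6; -6; -6; 4; -4; -6; -4; 6].

Definition paley_weights (R : realType) (i : 'I_12) : R := (doubled_weights`_i)%:~R / 2.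

Lemma extcoord_paley_weights (R : realType) (k : 'I_12) :
  extcoord paley12 (@paley_weights R) k = (doubled_coords`_k)%:~R / 2.
Proof.
have -> : doubled_coords`_k = \sum_(i < 12) doubled_weights`_i * (-1) ^+ paley_sign i k.
  rewrite -(big_mkord xpredT (fun i => doubled_weights`_i * (-1) ^+ paley_sign i k)).
  have : all (fun k => doubled_coords`_k ==
      foldr (fun i s => doubled_weights`_i * (-1) ^+ paley_sign i k + s) 0 (iota 0 12)) (iota 0 12).
    by vm_compute.
  move/allP/(_ k); rewrite mem_iota ltn_ord => /(_ isT)/eqP ->.
  by rewrite unlock.
rewrite rmorph_sum mulr_suml; apply: eq_bigr => i _.
by rewrite rmorphM rmorph_sign /paley_weights mulrAC.
Qed.

Lemma paley_weightsP (R : realType) : weights paley12 ord0 5 3 (@paley_weights R).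
Proof.
split=> [i||k k0].
- rewrite divr_ge0 // ler0z.
  have : all (fun i => 0 <= doubled_weights`_i) (iota 0 12) by [].
  by move/allP/(_ i); rewrite mem_iota ltn_ord; apply.
- by rewrite extcoord_paley_weights /=; field.
rewrite extcoord_paley_weights normrM normfV (@ger0_norm _ 2) // ler_pdivrMr // -intr_norm.
rewrite -natrM (_ : (3 * 2)%:R = (6 : int)%:~R :> R) // ler_int.
have : all (fun k => (k != 0%N) ==> (`|doubled_coords`_k| <= 6)) (iota 0 12) by [].
by move/allP/(_ k); rewrite mem_iota ltn_ord => /(_ isT)/implyP; apply.
Qed.

Ltac eval_signs :=
  repeat match goal with |- context [paley_sign ?i ?k] =>
    let b := eval vm_compute in (paley_sign i k) in
    change (paley_sign i k) with b end.

(** The six tight columns [0; 4; 5; 6; 9; 11] give a regular system for the six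
    nonzero weights. *)
Lemma paley_weights_rigid (R : realType) : rigid paley12 ord0 3 (@paley_weights R).
Proof.
move=> u uT uK.
pose w i := u (inord i).
have uE i : u i = w i by rewrite /w inord_val.
have wT i : (i < 12)%N -> doubled_weights`_i == 0 -> w i = 0.
  by move=> i12 /eqP hi; apply: uT; rewrite /paley_weights inordK // hi mul0r.
have wK k : (k < 12)%N -> (k == 0%N) || (`|doubled_coords`_k| == 6) ->
    \sum_(0 <= i < 12) w i * (-1) ^+ paley_sign i k = 0.
  move=> k12 hk; have /uK : Ordinal k12 \in tight paley12 ord0 3 (@paley_weights R).
    rewrite inE extcoord_paley_weights; case/orP: hk => [k0|/eqP hk].
      by rewrite -val_eqE /= k0.
    rewrite normrM normfV (@ger0_norm _ 2) // -intr_norm hk orbC.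
    by apply/orP; left; apply/eqP; field.
  by apply: etrans; rewrite big_mkord; apply: eq_bigr => i _; rewrite uE.
have := wK 0%N isT isT; have := wK 4 isT isT; have := wK 5 isT isT.
have := wK 6 isT isT; have := wK 9 isT isT; have := wK 11 isT isT.
rewrite unlock /=.
eval_signs.
rewrite !(wT 0%N, wT 3, wT 6, wT 7, wT 10, wT 11) // !mul0r !expr0 !expr1.
move=> e11 e9 e6 e5 e4 e0 i; rewrite uE.
have : (i < 12)%N by [].
move: (nat_of_ord i) => {}i.
do 12?[case: i => [|i]] => // _; first [by rewrite wT | lra].
Qed.

(** The first coordinate of the vertex is [2], whereas [n = 3] is odd. *)
Lemma nonintegral_truncation_11 (R : realType) : has_nonintegral_truncation R 11.
Proof.
exists (conv_hull (sign_point R paley12 ord0)), 5, 3.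
have g0 i : ~~ paley12 i ord0 by rewrite /paley12 /paley_sign /= andbF.
split=> //.
  by apply/hadamard_simplexP; exists paley12, ord0; split=> //; apply: paley12_hadamard.
exists (coords paley12 ord0 (@paley_weights R)); split.
  apply: rigid_vertex => //; [exact: paley12_hadamard|exact: paley_weightsP|].
  exact: paley_weights_rigid.
move=> /(_ ord0)[z]; rewrite mxE extcoord_paley_weights /=.
have -> : 4%:~R / 2 = 2%:~R :> R by field.
by move/eqP; rewrite eqr_int => /eqP; lia.
Qed.

Theorem corollary2p5 (R : realType) :
  has_nonintegral_truncation R 11 /\
  (forall d : nat, (d < 11)%N -> ~ has_nonintegral_truncation R d).
Proof.
split; first exact: nonintegral_truncation_11.
move=> d d11 [D [m [n [hD [om on] nmd [x [vx]]]]]]; apply.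
exact: (integral_truncation d11 hD om on nmd vx).
Qed.
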